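(* Let $T_{4,m}$ be the $(4,m)$-tadpole graph with $m\ge 1$ odd, i.e. the graph on vertices $1,\dots,4+m$ obtained by joining a cycle on the $4$ vertices $1,2,3,4$ (with edges $\{1,2\},\{2,3\},\{3,4\},\{4,1\}$) to a path on the $m$ vertices $5,6,\dots,4+m$ (with edges $\{i,i+1\}$ for $5\le i\le 3+m$) by the bridge $\{4,5\}$. Let $\mathcal{A}(T_{4,m})$ and $\mathcal{A}_{RW}(T_{4,m})$ be the evolution algebras associated to $T_{4,m}$ and to the symmetric random walk on $T_{4,m}$, respectively. Then the only homomorphism between $\mathcal{A}_{RW}(T_{4,m})$ and $\mathcal{A}(T_{4,m})$ is the null map. Thus $\mathcal{A}_{RW}(T_{4,m})\ncong\mathcal{A}(T_{4,m})$ as evolution algebras.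
   Context: Algebras are over a field $\mathbb{K}$. Let $G=(V,E)$ be a finite simple connected graph with adjacency matrix $A=(a_{ij})_{i,j\in V}$; let $\deg(i)=\sum_{k}a_{ik}$. The evolution algebra $\mathcal{A}(G)$ associated to $G$ is the algebra with basis $\{e_i\}_{i\in V}$ and bilinear product determined by $e_i\cdot e_i=\sum_{k\in V}a_{ik}e_k$ and $e_i\cdot e_j=0$ for $i\ne j$. The evolution algebra $\mathcal{A}_{RW}(G)$ associated to the symmetric random walk on $G$ is the algebra with basis $\{e_i\}_{i\in V}$ and bilinear product determined by $e_i\cdot e_i=\sum_{k\in V}\frac{a_{ik}}{\deg(i)}e_k$ and $e_i\cdot e_j=0$ for $i\neq j$. An algebra homomorphism is a $\mathbb{K}$-linear map $f$ with $f(xy)=f(x)f(y)$ for all $x,y$; an isomorphism (written $\cong$) is a bijective homomorphism. The null map is the map sending everything to $0$.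
   Formalization: The claim that the null map is the only homomorphism is proved for fields K in which -1 is not a square; it fails otherwise (e.g. K = C: e_1 -> e_1+s e_3, e_3 -> -(e_1+s e_3), other e_i -> 0, s^2 = -1). Non-isomorphism needs no such condition. All deg(i) are taken nonzero in K. *)

(* Defs.v *)
From HB Require Import structures.
From mathcomp Require Import all_boot all_order all_algebra.

Set Implicit Arguments.
Unset Strict Implicit.
Unset Printing Implicit Defensive.

Import GRing.Theory.
Local Open Scope ring_scope.

(* Not necessarily associative, commutative or unital. *)
Record algebra (K : fieldType) := MkAlgebra {
  carrier :> lmodType K;
  product : {bilinear carrier -> carrier -> carrier}
}.

Definition amul (K : fieldType) (A : algebra K) (x y : A) : A := product A x y.

Definition is_hom (K : fieldType) (A B : algebra K) (f : {linear A -> B}) :=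
  forall x y : A, f (amul x y) = amul (f x) (f y).

Definition isomorphic (K : fieldType) (A B : algebra K) :=
  exists2 f : {linear A -> B}, is_hom f & bijective f.

Section EvolutionAlgebra.
Variables (K : fieldType) (V : finType) (c : V -> V -> K).

(* [c i k] is the coefficient of e_k in e_i * e_i; vectors are their families
   of coordinates in the basis (e_i), and K^o is K as a vector space over
   itself. *)
Definition evo_mul (x y : {ffun V -> K^o}) : {ffun V -> K^o} :=
  [ffun k => \sum_i x i * y i * c i k].

Lemma evo_mul_bilinear :
  bilinear_for (GRing.Scale.Law.clone _ _ *:%R _)
               (GRing.Scale.Law.clone _ _ *:%R _) evo_mul.
Proof.
split=> [y|x] a u v; apply/ffunP=> k; rewrite !ffunE scaler_sumr -big_split /=;
  apply: eq_bigr=> i _; rewrite !ffunE /GRing.scale /=.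
- by rewrite !mulrDl !mulrA.
- by rewrite mulrDr mulrDl mulrCA !mulrA.
Qed.

HB.instance Definition _ :=
  bilinear_isBilinear.Build K _ _ _ _ _ evo_mul evo_mul_bilinear.

Definition evo_algebra : algebra K :=
  @MkAlgebra K {ffun V -> K^o} evo_mul.

Definition evo_basis (i : V) : evo_algebra := [ffun k => (k == i)%:R].

Lemma evo_basis_span (x : evo_algebra) : x = \sum_i x i *: evo_basis i.
Proof.
apply/ffunP=> k; rewrite sum_ffunE (bigD1 k) //= big1 => [|i nik].
  by rewrite !ffunE eqxx addr0 /GRing.scale /= mulr1.
by rewrite !ffunE eq_sym (negPf nik) scaler0.
Qed.

Lemma evo_mul_basis (i j : V) :
  amul (evo_basis i) (evo_basis j) =
  if i == j then \sum_k c i k *: evo_basis k else 0.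
Proof.
apply/ffunP=> k; rewrite /amul /= !ffunE (bigD1 i) //= big1 => [|l nli]; last first.
  by rewrite !ffunE (negPf nli) !mul0r.
rewrite !ffunE eqxx mul1r addr0; have [->|nij] := eqVneq i j; last first.
  by rewrite mul0r ffunE.
rewrite mul1r sum_ffunE (bigD1 k) //= big1 => [|l nlk].
  by rewrite !ffunE eqxx addr0 /GRing.scale /= mulr1.
by rewrite !ffunE eq_sym (negPf nlk) scaler0.
Qed.

End EvolutionAlgebra.

Record sgraph := SGraph {
  vertex :> finType;
  edge : rel vertex;
  edge_sym : symmetric edge;
  edge_irr : irreflexive edge
}.

Definition adj (G : sgraph) (i j : G) : nat := edge i j.

Definition deg (G : sgraph) (i : G) : nat := (\sum_k adj i k)%N.

Definition evo_graph (K : fieldType) (G : sgraph) : algebra K :=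
  evo_algebra (fun i k : G => (adj i k)%:R : K).

(* In MathComp 0^-1 = 0, so this is the intended algebra only when the image
   of every degree in K is nonzero. *)
Definition evo_rw (K : fieldType) (G : sgraph) : algebra K :=
  evo_algebra (fun i k : G => (adj i k)%:R / (deg i)%:R : K).

Section Tadpole.
Variable m : nat.

(* The ordinal i : 'I_(4 + m) stands for the vertex i + 1. *)
Definition tadpole4_arc (a b : nat) : bool :=
  [|| (a, b) \in [:: (1, 2); (2, 3); (3, 4); (4, 1)]%N,
      (a, b) == (4, 5)%N
    | [&& (5 <= a)%N, (a <= 3 + m)%N & b == a.+1]].

Definition tadpole4_edge : rel 'I_(4 + m) :=
  fun i j => tadpole4_arc i.+1 j.+1 || tadpole4_arc j.+1 i.+1.

Lemma tadpole4_edge_sym : symmetric tadpole4_edge.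
Proof. by move=> i j; rewrite /tadpole4_edge orbC. Qed.

Lemma tadpole4_edge_irr : irreflexive tadpole4_edge.
Proof.
move=> i; rewrite /tadpole4_edge orbb /tadpole4_arc !inE !xpair_eqE.
by rewrite -[_.+1 == _.+2](eqn_add2l 0) (ltn_eqF (ltnSn _)) !andbF;
  case: (nat_of_ord i) => [|[|[|[|[|?]]]]].
Qed.

Definition tadpole4 : sgraph := SGraph tadpole4_edge_sym tadpole4_edge_irr.

End Tadpole.

(* If -1 is a square in K, say s ^+ 2 = -1, then e_1 + s e_3 squares to 0 because
   the vertices 1 and 3 have the same neighbours, and it spans the image of a
   nonzero homomorphism. So over such a field the null map is not the only
   homomorphism. *)
Section Twins.
Variables (K : fieldType) (m : nat) (s : K).
Hypothesis s2 : s ^+ 2 = -1.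
Let G := tadpole4 m.
Let a : G := @Ordinal (4 + m) 0 isT.
Let b : G := @Ordinal (4 + m) 2 isT.

Lemma adj_twinr (i : G) : adj i a = adj i b.
Proof.
rewrite /adj /edge /= /tadpole4_edge /tadpole4_arc !inE !xpair_eqE /=.
by case: i => [[|[|[|[|[|i]]]]] hi] //=; rewrite ?andbF ?eqSS.
Qed.

Lemma adj_twinl (i : G) : adj a i = adj b i.
Proof. by rewrite /adj ![edge _ i]edge_sym; exact: adj_twinr. Qed.

Definition twin_hom (x : evo_rw K G) : evo_graph K G :=
  (x a - x b) *: (evo_basis _ a + s *: evo_basis _ b).

Lemma twin_hom_lin : linear twin_hom.
Proof.
move=> c x y; rewrite /twin_hom !ffunE scalerA -scalerDl; congr (_ *: _).
by rewrite /GRing.scale /= mulrBr opprD addrACA.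
Qed.
HB.instance Definition _ := GRing.isLinear.Build K _ _ _ twin_hom twin_hom_lin.

Lemma twin_hom_is_hom : is_hom twin_hom.
Proof.
move=> x y; have z : twin_hom (amul x y) = 0.
  rewrite /twin_hom /amul /= !ffunE -sumrB big1 ?scale0r // => i _.
  by rewrite adj_twinr subrr.
apply: (etrans z); rewrite /= /twin_hom; apply/ffunP=> k; rewrite /amul /= !ffunE.
rewrite (bigD1 a) //= (bigD1 b) //= big1 => [|i /andP[na nb]]; last first.
  by rewrite !ffunE (negPf na) (negPf nb) /GRing.scale /= !(mulr0, addr0, mul0r).
have E := adj_twinl k.
rewrite !ffunE /= E /GRing.scale /= !(mulr0, mulr1, addr0, add0r).
by rewrite mulrACA -expr2 s2 -mulrDl mulrN1 addrN mul0r.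
Qed.

Lemma twin_hom_neq0 : twin_hom (evo_basis _ a) != 0.
Proof.
apply/eqP => /ffunP /(_ a); rewrite !ffunE /= /GRing.scale /=.
by rewrite subr0 mulr0 addr0 mul1r => /eqP; rewrite oner_eq0.
Qed.
End Twins.

(* Main.v *)
(** For odd [m] the kernel of the adjacency matrix of T_{4,m} is spanned by
    e_1 - e_3.  Hence xy = 0 in either algebra means that x and y have disjoint
    supports outside {1,3} and orthogonal (1,3)-parts.  If -1 is not a square
    this makes both algebras reduced, so a homomorphism f kills e_i iff it kills
    every e_k with k adjacent to i: f is null or, the f(e_i) being nonzero and
    pairwise orthogonal, injective.

    An injective f is impossible over any field.  As e_1^2 = e_3^2 and
    e_1 e_3 = 0, it maps span(e_1, e_3) to itself, and every other e_i to a vector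
    supported off {1,3}.  The squares of e_1, e_2 and e_4 then force
    f(e_2) = t e_2 and f(e_4) = t e_4 with the same t != 0, and comparing the
    e_1-coordinates of f(e_2)^2 and f(e_4)^2 shows that the ratio of the weights
    of the vertices 2 and 4 is the same in the two algebras, whereas deg(2) = 2
    and deg(4) = 3. *)

Require Import Defs.
From mathcomp Require Import all_boot all_order all_algebra.
From mathcomp Require Import zify ring.

Set Implicit Arguments.
Unset Strict Implicit.
Unset Printing Implicit Defensive.

Import GRing.Theory.
Local Open Scope ring_scope.

(** * Homomorphisms out of an evolution algebra *)

Section EvolutionHom.
Variables (K : fieldType) (V : finType) (c : V -> V -> K) (B : algebra K).
Variable f : {linear evo_algebra c -> B}.
Hypothesis f_hom : is_hom f.

Let v i := f (evo_basis c i).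

Lemma amul0r (x : B) : amul 0 x = 0.
Proof. exact: linear0l. Qed.

Lemma amul_suml (a : V -> K) (u : V -> B) (x : B) :
  amul (\sum_i a i *: u i) x = \sum_i a i *: amul (u i) x.
Proof.
rewrite /amul linear_sumlz; apply: eq_bigr => i _; exact: linearZl_LR.
Qed.

Lemma hom_basisE (x : evo_algebra c) : f x = \sum_i x i *: v i.
Proof.
rewrite {1}[x]evo_basis_span linear_sum; apply: eq_bigr => i _; exact: linearZ.
Qed.

Lemma hom_basis_orth i j : i != j -> amul (v i) (v j) = 0.
Proof.
by move=> /negPf nij; rewrite /v -f_hom evo_mul_basis nij linear0.
Qed.

Lemma hom_basis_sqr i : amul (v i) (v i) = \sum_k c i k *: v k.
Proof.
rewrite /v -f_hom evo_mul_basis eqxx linear_sum; apply: eq_bigr => k _.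
exact: linearZ.
Qed.

Lemma amul_hom_basis (a : V -> K) j :
  amul (\sum_i a i *: v i) (v j) = a j *: amul (v j) (v j).
Proof.
rewrite amul_suml (bigD1 j) //= big1 ?addr0 // => i nij.
by rewrite hom_basis_orth // scaler0.
Qed.

Hypothesis B_reduced : forall x : B, amul x x = 0 -> x = 0.

(** Multiplying the expansion of [v i] squared by [v j] leaves [c i j] times the square of [v j]; if
    [v i = 0], that square vanishes and reducedness gives [v j = 0]. *)
Lemma hom_basis_eq0_step i j : c i j != 0 -> v i = 0 -> v j = 0.
Proof.
move=> cij vi0; apply: B_reduced; apply/eqP.
have := amul_hom_basis (c i) j.
rewrite -hom_basis_sqr vi0 !amul0r => /esym/eqP.
by rewrite scaler_eq0 (negPf cij).
Qed.

(** Multiplying [f x = 0] by [v j] isolates [x j] times the square of [v j], which is nonzero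
    because [B] is reduced. *)
Lemma hom_inj : (forall i, v i != 0) -> injective f.
Proof.
move=> v_neq0; apply: raddf_inj => x fx0; apply/ffunP => j; rewrite ffunE.
have := amul_hom_basis x j; rewrite -hom_basisE fx0 amul0r => /esym/eqP.
rewrite scaler_eq0 => /orP[/eqP //|/eqP/B_reduced vj0].
by have := v_neq0 j; rewrite vj0 eqxx.
Qed.

End EvolutionHom.

(** * Neighbourhoods and adjacency kernel of the tadpole *)

Section TadpoleGraph.
Variable m : nat.
Let G := tadpole4 m.

(* [vtx n] stands for the vertex n + 1; it is a junk vertex when n >= 4 + m. *)
Definition vtx (n : nat) : G := @inord (3 + m) n.

Lemma vtxK n : (n < 4 + m)%N -> vtx n = n :> nat.
Proof. by move=> h; rewrite inordK. Qed.

Lemma vtx_val (i : G) : vtx i = i.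
Proof. exact: inord_val. Qed.

(** Vertices are indexed from 0. The list of the last path vertex contains the out-of-range index
    [4 + m]. *)
Definition nbrs (n : nat) : seq nat :=
  match n with
  | 0 | 2 => [:: 1; 3]
  | 1 => [:: 0; 2]
  | 3 => [:: 0; 2; 4]
  | n'.+1 => [:: n'; n'.+2]
  end%N.

Lemma nbrs_uniq n : uniq (nbrs n).
Proof. by case: n => [|[|[|[|n]]]] //=; rewrite inE; lia. Qed.

Lemma adjE (i j : G) : adj i j = (nat_of_ord i \in nbrs j).
Proof.
rewrite /adj /edge /= /tadpole4_edge /tadpole4_arc !inE !xpair_eqE /=.
by congr nat_of_bool; case: i j => [i hi] [j hj] /=; case: j hj => [|[|[|[|j]]]] hj /=;
  rewrite ?inE; lia.
Qed.

Lemma adj_sym (i j : G) : adj i j = adj j i.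
Proof. by rewrite /adj edge_sym. Qed.

Section NeighbourSums.
Variable (U : nmodType).

(** Extension by zero makes the out-of-range neighbour harmless, so the end of the path obeys the
    same two-term relation as its interior. *)
Definition ext (F : G -> U) (n : nat) : U :=
  if (n < 4 + m)%N then F (vtx n) else 0.

Lemma ext_vtx F n : (n < 4 + m)%N -> ext F n = F (vtx n).
Proof. by rewrite /ext => ->. Qed.

Lemma ext_val F (i : G) : ext F i = F i.
Proof. by rewrite ext_vtx ?vtx_val ?ltn_ord. Qed.

Lemma sum_adj F (j : G) : \sum_i F i *+ adj i j = \sum_(n <- nbrs j) ext F n.
Proof.
under eq_bigr => i _ do rewrite adjE.
elim: (nbrs j) (nbrs_uniq j) => [|n s IHs] /=.
  by move=> _; rewrite big_nil big1.
case/andP=> /negPf ns us; rewrite big_cons -IHs //.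
rewrite (eq_bigr (fun i : G => F i *+ (nat_of_ord i == n) + F i *+ (nat_of_ord i \in s))); last first.
  move=> i _; rewrite inE; have [->|] := eqVneq (nat_of_ord i) n; last by rewrite mulr0n add0r.
  by rewrite ns mulr0n addr0.
rewrite big_split /=; congr (_ + _); rewrite /ext; case: ltnP => hn.
  rewrite (bigD1 (vtx n)) //= vtxK // eqxx mulr1n big1 ?addr0 // => i ni.
  case: eqP => // ein; case/eqP: ni; apply: val_inj; by rewrite /= vtxK.
by rewrite big1 // => i _; case: eqP => // ein; have := ltn_ord i; move: ein => /= ->; lia.
Qed.

End NeighbourSums.

(** The equations at 1 and 3 give [F 4 = 0]. Along the path [F (n-1) + F (n+1) = 0], so zeros spread
    upwards from 4 through the even indices, and downwards from the index [4 + m], odd like [m],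
    through the odd ones to 3. The equation at 0 then gives [F 1 = 0]. *)
Lemma adj_kernel (U : zmodType) (F : G -> U) : odd m ->
  (forall j, \sum_i F i *+ adj i j = 0) ->
  F (vtx 0) + F (vtx 2) = 0 /\
  (forall i : G, (val i != 0)%N -> (val i != 2)%N -> F i = 0).
Proof.
move=> m_odd F0.
have E n : (n < 4 + m)%N -> \sum_(k <- nbrs n) ext F k = 0.
  by move=> hn; have := F0 (vtx n); rewrite sum_adj vtxK.
have E02 : ext F 0 + ext F 2 = 0 
  by have := E 1%N isT; rewrite !big_cons big_nil addr0.
have E4 : ext F 4 = 0.
  by have := E 3%N isT; rewrite !big_cons big_nil addr0 addrA E02 add0r.
have step n : (4 <= n < 4 + m)%N -> ext F n.-1 + ext F n.+1 = 0.
  case: n => [|[|[|[|n]]]] //= hn; have := E n.+4 hn.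
  by rewrite !big_cons big_nil addr0.
have out n : (4 + m <= n)%N -> ext F n = 0 by rewrite /ext ltnNge => ->.
have even_ n : ext F (4 + n.*2) = 0.
  elim: n => [//|n IHn]; have [h|h] := leqP (4 + m) (4 + n.+1.*2); first exact: out.
  have := step (5 + n.*2)%N; rewrite /= IHn add0r doubleS => -> //; lia.
(* Downward induction with [k] bounding the distance to the end; for [k = 0], oddness of [m] makes
   [m <= n.*2] strict, so the index is out of range. *)
have odd_ k n : (m <= n.*2 + k)%N -> ext F (3 + n.*2) = 0.
  elim: k n => [|k IHk] n h; first by apply: out; move: m_odd h; lia.
  have [h'|h'] := leqP (4 + m) (3 + n.*2); first exact: out.
  have := step (4 + n.*2)%N; rewrite /= (_ : (4 + n.*2).+1 = 3 + n.+1.*2)%N; last by lia.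
  rewrite (IHk n.+1) ?addr0; last by lia.
  by apply; lia.
have E3 : ext F 3 = 0 by apply: (odd_ m 0%N).
have E1 : ext F 1 = 0.
  by have := E 0%N isT; rewrite !big_cons big_nil E3 !addr0.
split; first by move: E02; rewrite !ext_vtx.
move=> i; rewrite -(ext_val F i) /=; move: (nat_of_ord i) => n n0 n2.
have [->//|n1] := eqVneq n 1%N.
case: (boolP (odd n)) => on.
  rewrite (_ : n = 3 + (n - 3)./2.*2)%N; last by lia.
  by apply: (odd_ m); lia.
by rewrite (_ : n = 4 + (n - 4)./2.*2)%N //; lia.
Qed.

Lemma adj_twin0 (i : G) : adj (vtx 0) i = adj (vtx 2) i.
Proof.
by rewrite adj_sym (adj_sym _ i) !adjE !vtxK.
Qed.

End TadpoleGraph.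

(** * Products in a weighted tadpole algebra *)

Section WeightedTadpole.
Variables (K : fieldType) (m : nat).
Let G := tadpole4 m.
Hypotheses (m_ge1 : (0 < m)%N) (m_odd : odd m).
(* The weights [q = 1] and [q = 1 / deg] give [evo_graph] and [evo_rw]. *)
Variables (d : G -> G -> K) (q : G -> K).
Hypothesis dE : forall i k, d i k = (adj i k)%:R * q i.
Hypothesis q_neq0 : forall i, q i != 0.
Hypothesis q02 : q (vtx m 0) = q (vtx m 2).

Let E : algebra K := evo_algebra d.
Implicit Types x y : E.

Let v0 := vtx m 0.
Let v1 := vtx m 1.
Let v2 := vtx m 2.
Let v3 := vtx m 3.
Let v4 := vtx m 4.

(** The products [a i * q i] lie in the adjacency kernel; the nonzero weights cancel, the twins
    having the same one. *)
Lemma weighted_kernel (a : G -> K) : (forall j, \sum_i a i * d i j = 0) ->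
  a v0 + a v2 = 0 /\ (forall i : G, i != v0 -> i != v2 -> a i = 0).
Proof.
move=> a0; have [|h h'] := @adj_kernel m K (fun i => a i * q i) m_odd.
  move=> j; apply: (etrans _ (a0 j)); apply: eq_bigr => i _.
  by rewrite dE mulrCA mulr_natl.
split.
  by apply/(mulIf (q_neq0 v0)); rewrite mul0r mulrDl {2}q02.
move=> i i0 i2; apply/(mulIf (q_neq0 i)); rewrite mul0r h' //.
  by apply: contraNneq i0 => i0; apply/eqP/val_inj; rewrite /= i0 vtxK.
by apply: contraNneq i2 => i2; apply/eqP/val_inj; rewrite /= i2 vtxK.
Qed.

Lemma amul_evoE x y (j : G) : amul x y j = \sum_i x i * y i * d i j.
Proof. by rewrite /amul /= ffunE. Qed.

Lemma amul_eq0 x y : amul x y = 0 ->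
  x v0 * y v0 + x v2 * y v2 = 0 /\
  (forall i : G, i != v0 -> i != v2 -> x i * y i = 0).
Proof.
move=> xy0; apply: (@weighted_kernel (fun i => x i * y i)) => j.
by rewrite -amul_evoE xy0 ffunE.
Qed.

(** Off the twins a square coordinate is zero; on them a sum of two squares vanishes, and a nonzero
    solution would make -1 a square. *)
Lemma weighted_reduced x :
  (forall s : K, s ^+ 2 != -1) -> amul x x = 0 -> x = 0.
Proof.
move=> nsq /amul_eq0[x02 xi].
have aniso (a b : K) : a * a + b * b = 0 -> a = 0.
  move=> ab; apply/eqP; apply: contraT => a0; case/eqP: (nsq (b / a)).
  have -> : (b / a) ^+ 2 = b * b / (a * a) by field.
  have -> : b * b = - (a * a) by apply/eqP; rewrite -addr_eq0 addrC ab.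
  by rewrite mulNr mulfV ?mulf_neq0.
apply/ffunP => i; rewrite [RHS]ffunE; have [->|i0] := eqVneq i v0.
  exact: aniso x02.
have [->|i2] := eqVneq i v2; first by apply: aniso; rewrite addrC; exact: x02.
by have /eqP := xi i i0 i2; rewrite mulf_eq0 orbb => /eqP.
Qed.

(** Only the twins contribute, and they share both their neighbours and their weight. *)
Lemma amul_twins x y (j : G) :
  (forall i : G, i != v0 -> i != v2 -> x i * y i = 0) ->
  amul x y j = (x v0 * y v0 + x v2 * y v2) * q v0 * (adj v0 j)%:R.
Proof.
move=> xi; rewrite amul_evoE (bigD1 v0) //= (bigD1 v2) //=; last first.
  by rewrite -val_eqE /= !vtxK.
rewrite big1 => [|i /andP[i0 i2]]; last by rewrite xi // mul0r.
by rewrite !dE -q02 -adj_twin0 addr0; ring.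
Qed.

(** * Homomorphisms between two weightings of the tadpole *)

Section Hom.
Variables (c : G -> G -> K) (p : G -> K).
Hypothesis cE : forall i k, c i k = (adj i k)%:R * p i.
Hypothesis p_neq0 : forall i, p i != 0.
Variable f : {linear evo_algebra c -> E}.
Hypothesis f_hom : is_hom f.

Let v i := f (evo_basis c i) : E.

Lemma hom_tadpole_sqr n : (n < 4 + m)%N ->
  amul (v (vtx m n)) (v (vtx m n)) =
  p (vtx m n) *: \sum_(k <- nbrs n) ext v k.
Proof.
move=> hn; rewrite /v (hom_basis_sqr f_hom) -{3}(vtxK hn) -sum_adj scaler_sumr.
apply: eq_bigr => k _.
by rewrite cE adj_sym -scaler_nat scalerA mulrC.
Qed.

(** If some [v i] is zero, vanishing spreads along edges; the Hamiltonian path 0, 1, 2, ... carries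
    it down to 0 and then up to every vertex. *)
Lemma hom_eq0_or_inj :
  (forall s : K, s ^+ 2 != -1) -> (forall x, f x = 0) \/ injective f.
Proof.
move=> nsq.
have [/forallP vn0|] := boolP [forall i, v i != 0].
  by right; apply: (hom_inj f_hom) => // x; exact: weighted_reduced.
rewrite negb_forall => /existsP[i]; rewrite negbK => /eqP vi0; left.
have step (j k : G) : adj j k != 0%N -> v j = 0 -> v k = 0.
  move=> jk; apply: (hom_basis_eq0_step f_hom) => [x|].
    exact: weighted_reduced.
  by rewrite cE mulf_neq0 //; move: jk; rewrite /adj; case: edge; rewrite ?oner_eq0.
have adjS n : (n.+1 < 4 + m)%N -> adj (vtx m n) (vtx m n.+1) != 0%N.
  move=> hn; rewrite adjE !vtxK //; last exact: ltnW.
  by move: n hn => [|[|[|[|n]]]] _; rewrite /= ?inE ?eqxx.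
have down n k : (n + k < 4 + m)%N -> v (vtx m (n + k)) = 0 -> v (vtx m n) = 0.
  elim: k => [|k IHk]; first by rewrite addn0.
  rewrite addnS => h vk; apply: IHk; first by lia.
  by apply: (step _ _ _ vk); rewrite adj_sym adjS.
have up n : (n < 4 + m)%N -> v (vtx m n) = 0.
  elim: n => [|n IHn] h; last by apply: (step _ _ (adjS n h)); apply: IHn; lia.
  by apply: (down 0%N i); rewrite ?vtx_val ?ltn_ord.
move=> x; rewrite hom_basisE big1 // => j _.
by have := up j (ltn_ord j); rewrite /v vtx_val => ->; rewrite scaler0.
Qed.

(** The condition on weights says that the ratio between vertices 1 and 3 differs in the two
    algebras. The argument also covers fields where -1 is a square, as the non-isomorphism claim
    requires. *)
Lemma weighted_no_inj :
  p v0 = p v2 -> p v1 * q v3 != p v3 * q v1 -> ~ injective f.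
Proof.
move=> p02 pq f_inj; pose T i k : K := v i k.
have e0 : v0 = 0%N :> nat by rewrite vtxK.
have e1 : v1 = 1%N :> nat by rewrite vtxK.
have e2 : v2 = 2%N :> nat by rewrite vtxK.
have e3 : v3 = 3%N :> nat by rewrite vtxK.
have e4 : v4 = 4%N :> nat by rewrite vtxK //; lia.
have ne (i j : G) : nat_of_ord i != nat_of_ord j -> i != j by [].
have orth i j (nij : i != j) : T i v0 * T j v0 + T i v2 * T j v2 = 0 /\
    (forall k, k != v0 -> k != v2 -> T i k * T j k = 0).
  exact: amul_eq0 (hom_basis_orth f_hom nij).
have sq0 l : amul (v v0) (v v0) l = p v0 * (T v1 l + T v3 l) :> K.
  by rewrite hom_tadpole_sqr // !big_cons big_nil addr0 !ext_vtx // !ffunE.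
have sq2 l : amul (v v2) (v v2) l = p v0 * (T v1 l + T v3 l) :> K.
  by rewrite hom_tadpole_sqr // !big_cons big_nil addr0 !ext_vtx // !ffunE p02.
have sq1 l : amul (v v1) (v v1) l = p v1 * (T v0 l + T v2 l) :> K.
  by rewrite hom_tadpole_sqr // !big_cons big_nil addr0 !ext_vtx // !ffunE.
have sq3 l : amul (v v3) (v v3) l = p v3 * (T v0 l + (T v2 l + T v4 l)) :> K.
  by rewrite hom_tadpole_sqr // !big_cons big_nil addr0 !ext_vtx // !ffunE.
have indep a b : (forall k, a * T v0 k + b * T v2 k = 0) -> a = 0 /\ b = 0.
  move=> ab; have n20 : (v2 == v0) = false by rewrite -val_eqE /= e0 e2.
  have : a *: evo_basis c v0 + b *: evo_basis c v2 = 0.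
    apply: f_inj; rewrite linearD !linearZ linear0; apply/ffunP => k.
    by rewrite !ffunE; exact: ab.
  move/ffunP => h; split.
    by have := h v0; rewrite !ffunE eqxx eq_sym n20 /GRing.scale /= mulr1 mulr0 addr0.
  by have := h v2; rewrite !ffunE eqxx n20 /GRing.scale /= mulr1 mulr0 add0r.
have n02 : v0 != v2 by apply: ne; rewrite e0 e2.
have [_ orth02'] := orth v0 v2 n02.
(* The images of the twins have equal squares, so off the twins their coordinates have equal
   squares, and by orthogonality product zero. *)
have supp02 k : k != v0 -> k != v2 -> T v0 k = 0 /\ T v2 k = 0.
  move=> k0 k2.
  have sqk : T v0 k * T v0 k = T v2 k * T v2 k.
    have [|_ /(_ k k0 k2) h] :=
      @weighted_kernel (fun k => T v0 k * T v0 k - T v2 k * T v2 k).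
      move=> j; under eq_bigr => i _ do rewrite mulrBl.
      by rewrite sumrB -!amul_evoE sq0 sq2 subrr.
    by apply/eqP; rewrite -subr_eq0 h.
  have /eqP := orth02' k k0 k2; rewrite mulf_eq0 => /orP[]/eqP z; move: sqk; rewrite z mul0r.
    by move=> /esym/eqP; rewrite mulf_eq0 orbb => /eqP.
  by move=> /eqP; rewrite mulf_eq0 orbb => /eqP.
(* The two images live on the twin coordinates. Were the determinant zero, the two relations below
   would force all four entries to vanish, against injectivity. *)
have det_neq0 : T v0 v0 * T v2 v2 - T v0 v2 * T v2 v0 != 0.
  apply/eqP => det0.
  have [|a0 b0] := indep (T v2 v0) (- T v0 v0).
    move=> k; have [->|k0] := eqVneq k v0; first by ring.
    have [->|k2] := eqVneq k v2; first by rewrite -[RHS]oppr0 -det0; ring.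
    by have [-> ->] := supp02 k k0 k2; rewrite !mulr0 addr0.
  have [|a2 b2] := indep (T v2 v2) (- T v0 v2).
    move=> k; have [->|k0] := eqVneq k v0; first by rewrite -det0; ring.
    have [->|k2] := eqVneq k v2; first by ring.
    by have [-> ->] := supp02 k k0 k2; rewrite !mulr0 addr0.
  have [|/eqP] := indep 1 0; last by rewrite oner_eq0.
  move=> k; rewrite mul1r mul0r addr0.
  have [->|k0] := eqVneq k v0; first by rewrite -[LHS]opprK b0 oppr0.
  have [->|k2] := eqVneq k v2; first by rewrite -[LHS]opprK b2 oppr0.
  by have [] := supp02 k k0 k2.
(* Orthogonality to both twin images is an invertible 2 by 2 system, solved by Cramer's rule. *)
have off i : i != v0 -> i != v2 -> T i v0 = 0 /\ T i v2 = 0.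
  move=> i0 i2; have [E0 _] := orth i v0 i0; have [E2 _] := orth i v2 i2.
  split; apply: (mulIf det_neq0); rewrite mul0r.
    transitivity (T v2 v2 * (T i v0 * T v0 v0 + T i v2 * T v0 v2)
      - T v0 v2 * (T i v0 * T v2 v0 + T i v2 * T v2 v2)); first by ring.
    by rewrite E0 E2 !mulr0 subrr.
  transitivity (T v0 v0 * (T i v0 * T v2 v0 + T i v2 * T v2 v2)
    - T v2 v0 * (T i v0 * T v0 v0 + T i v2 * T v0 v2)); first by ring.
  by rewrite E0 E2 !mulr0 subrr.
have n10 : v1 != v0 by apply: ne; rewrite e0 e1.
have n12 : v1 != v2 by apply: ne; rewrite e2 e1.
have n13 : v1 != v3 by apply: ne; rewrite e3 e1.
have n30 : v3 != v0 by apply: ne; rewrite e0 e3.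
have n32 : v3 != v2 by apply: ne; rewrite e2 e3.
have n40 : v4 != v0 by apply: ne; rewrite e0 e4.
have n42 : v4 != v2 by apply: ne; rewrite e2 e4.
pose s := (T v0 v0 * T v0 v0 + T v0 v2 * T v0 v2) * q v0.
have sum13 l : p v0 * (T v1 l + T v3 l) = s * (adj v0 l)%:R.
  rewrite -sq0 amul_twins // => i i0 i2.
  by have [h _] := supp02 i i0 i2; rewrite (h : v v0 i = 0) mul0r.
have [_ orth13] := orth v1 v3 n13.
(* By [sum13], [T v1 + T v3] is supported on the neighbours [v1] and [v3] of [v0]. Elsewhere the two
   coordinates are opposite with product zero. *)
have supp13 l : l != v1 -> l != v3 -> T v1 l = 0 /\ T v3 l = 0.
  move=> l1 l3.
  have [->|l0] := eqVneq l v0; first by rewrite (off v1 n10 n12).1 (off v3 n30 n32).1.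
  have [->|l2] := eqVneq l v2; first by rewrite (off v1 n10 n12).2 (off v3 n30 n32).2.
  have : p v0 * (T v1 l + T v3 l) = 0.
    rewrite sum13 adj_sym adjE e0 !inE.
    have /negPf-> : nat_of_ord l != 1%N.
      by apply: contraNneq l1 => l1; apply/eqP/val_inj; rewrite /= l1 e1.
    have /negPf-> : nat_of_ord l != 3%N.
      by apply: contraNneq l3 => l3; apply/eqP/val_inj; rewrite /= l3 e3.
    by rewrite mulr0.
  move/eqP; rewrite mulf_eq0 (negPf (p_neq0 _)) addr_eq0 /= => /eqP z.
  have /eqP := orth13 l l0 l2; rewrite z mulNr oppr_eq0 mulf_eq0 orbb => /eqP z'.
  by rewrite z' oppr0.
have sq_supp13 i l : (forall k, k != v1 -> k != v3 -> T i k = 0) ->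
    amul (v i) (v i) l = T i v1 * T i v1 * q v1 * (adj v1 l)%:R
                       + T i v3 * T i v3 * q v3 * (adj v3 l)%:R :> K.
  move=> Ti; rewrite amul_evoE (bigD1 v1) //= (bigD1 v3) //=; last by rewrite eq_sym.
  rewrite big1 ?addr0 => [|k /andP[k1 k3]].
    by rewrite !dE; congr (_ + _); rewrite /T; ring.
  by rewrite (Ti k k1 k3 : v i k = 0) !mul0r.
have adj10 : adj v1 v0 = 1%N by rewrite adjE e0 e1.
have adj30 : adj v3 v0 = 1%N by rewrite adjE e0 e3.
have adj14 : adj v1 v4 = 0%N by rewrite adjE e4 e1.
have adj34 : adj v3 v4 = 1%N by rewrite adjE e4 e3.
have supp1 k : k != v1 -> k != v3 -> T v1 k = 0 by move=> k1 k3; have [] := supp13 k k1 k3.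
have supp3 k : k != v1 -> k != v3 -> T v3 k = 0 by move=> k1 k3; have [] := supp13 k k1 k3.
(* The bridge breaks the symmetry between [v1] and [v3]: only [v3] is adjacent to [v4], so the
   [v4]-coordinate of the square isolates [T v1 v3]. *)
have T13 : T v1 v3 = 0.
  have := sq1 v4; rewrite sq_supp13 // adj14 adj34 mulr0 add0r mulr1.
  have [-> ->] := supp02 v4 n40 n42; rewrite addr0 mulr0 => /eqP.
  by rewrite !mulf_eq0 (negPf (q_neq0 _)) orbF orbb => /eqP.
have T11 : T v1 v1 != 0.
  apply/eqP => T11; have : evo_basis c v1 = 0.
    apply: f_inj; rewrite linear0; apply/ffunP => k; rewrite [RHS]ffunE.
    have [->|k1] := eqVneq k v1; first exact: T11.
    by have [->|k3] := eqVneq k v3; [exact: T13 | exact: supp1].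
  by move/ffunP/(_ v1); rewrite !ffunE eqxx => /eqP; rewrite oner_eq0.
have T31 : T v3 v1 = 0.
  by have /eqP := orth13 v1 n10 n12; rewrite mulf_eq0 (negPf T11) => /eqP.
(* By [sum13] at [v1] and at [v3], both sides times [p v0] equal [s]. *)
have T33 : T v3 v3 = T v1 v1.
  apply: (mulfI (p_neq0 v0)).
  have := sum13 v1; rewrite T31 addr0 adj_sym => ->.
  have := sum13 v3; rewrite T13 add0r adj_sym => ->.
  by rewrite !adjE e1 e3 e0.
have [T40 _] := off v4 n40 n42.
(* Both squares, read at [v0], involve the same sum [T v0 v0 + T v2 v0]; cross-multiplying
   eliminates it and leaves the excluded equality of ratios. *)
have := sq1 v0; rewrite sq_supp13 // adj10 adj30 T13 !mul0r addr0 mulr1 => E1.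
have := sq3 v0; rewrite sq_supp13 // adj10 adj30 T31 T33 T40 !mul0r add0r addr0 mulr1 => E3.
case/eqP: pq; apply: (mulfI (mulf_neq0 T11 T11)).
by rewrite mulrCA E3 [RHS]mulrCA E1; ring.
Qed.

End Hom.
End WeightedTadpole.

(** * Degrees, and the two algebras as weighted tadpoles *)

Lemma tadpole_degE (K : fieldType) (m n : nat) : (n < 4 + m)%N ->
  (deg (vtx m n))%:R = \sum_(k <- nbrs n) ext (fun _ : tadpole4 m => 1 : K) k.
Proof.
move=> hn; rewrite -{2}(vtxK hn) -sum_adj natr_sum.
by apply: eq_bigr => k _; rewrite adj_sym.
Qed.

Theorem proposition3p3 (K : fieldType) (m : nat) (m_ge1 : (1 <= m)%N)
    (m_odd : odd m)
    (deg_neq0 : forall i : tadpole4 m, (deg i)%:R != 0 :> K) :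
  ((forall x : K, x ^+ 2 != -1) ->
     (forall f : {linear evo_rw K (tadpole4 m) -> evo_graph K (tadpole4 m)},
        is_hom f <-> forall x, f x = 0) /\
     (forall f : {linear evo_graph K (tadpole4 m) -> evo_rw K (tadpole4 m)},
        is_hom f <-> forall x, f x = 0)) /\
  ~ isomorphic (evo_rw K (tadpole4 m)) (evo_graph K (tadpole4 m)).
Proof.
pose w (i : tadpole4 m) : K := (deg i)%:R^-1; pose u (i : tadpole4 m) : K := 1.
have w_neq0 i : w i != 0 by rewrite invr_eq0.
have u_neq0 i : u i != 0 by rewrite oner_eq0.
have uE i k : (adj i k)%:R = (adj i k)%:R * u i by rewrite mulr1.
have w02 : w (vtx m 0) = w (vtx m 2) by rewrite /w !tadpole_degE.
(* The degrees 2 and 3 differ by 1, hence have distinct images in any characteristic. *)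
have w13 : w (vtx m 1) != w (vtx m 3).
  rewrite (inj_eq invr_inj) !tadpole_degE // !big_cons big_nil !ext_vtx //.
  by rewrite !(inj_eq (addrI _)) addr0 eq_sym oner_eq0.
have rw_no_inj (f : {linear evo_rw K (tadpole4 m) -> evo_graph K (tadpole4 m)}) :
    is_hom f -> ~ injective f.
  move=> f_hom; apply: (weighted_no_inj m_ge1 m_odd uE _ _ (p := w) _ _ f_hom) => //.
  by rewrite !mulr1.
have graph_no_inj (f : {linear evo_graph K (tadpole4 m) -> evo_rw K (tadpole4 m)}) :
    is_hom f -> ~ injective f.
  move=> f_hom; apply: (weighted_no_inj m_ge1 m_odd (q := w) _ _ _ uE _ f_hom) => //.
  by rewrite !mul1r eq_sym.
have null_hom (A B : algebra K) (f : {linear A -> B}) : (forall x, f x = 0) -> is_hom f.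
  by move=> f0 x y; rewrite !f0 amul0r.
split=> [nsq|[f f_hom /bij_inj]]; last exact: rw_no_inj.
split=> f; split=> [f_hom|]; try exact: null_hom.
  by have [//|/(rw_no_inj f f_hom)] :=
    hom_eq0_or_inj m_ge1 m_odd uE u_neq0 (erefl _) (fun _ _ => erefl) w_neq0 f_hom nsq.
by have [//|/(graph_no_inj f f_hom)] :=
  hom_eq0_or_inj m_ge1 m_odd (fun _ _ => erefl) w_neq0 w02 uE u_neq0 f_hom nsq.
Qed.
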